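(* Let $S$ be a finite left-regular band (LRB) with identity, with lattice of supports $L$, and let $w=\sum_{x\in S}w_x x\in\mathbb{R}S$ be a probability distribution on $S$ (i.e. $w_x\ge 0$, $\sum_x w_x=1$). Assume that $S$ is generated, as a semigroup with identity, by $\{x\in S:w_x\ne 0\}$. For $X\in L$ put $$e_X=\sum_{\mathbf{x}}R_{X,\mathbf{x}}\,w_{\mathbf{x}}\,\bar{\mathbf{x}}\in\mathbb{R}S,$$ where $\mathbf{x}$ ranges over all reduced words whose associated chain passes through $X$. Then the $e_X$, $X\in L$, form an orthogonal family of idempotents ($e_X^2=e_X$, and $e_Xe_Y=0$ for $X\neq Y$) such that $$w=\sum_{X\in L}\lambda_X e_X .$$ If $w$ is generic, meaning $\lambda_X\ne\lambda_Y$ whenever $X\neq Y$ in $L$, then the $e_X$ are the primitive idempotents of $\mathbb{R}[w]$. In general, the decomposition of $w$ as a linear combination of the primitive idempotents of $\mathbb{R}[w]$ is obtained by grouping the terms of this sum according to the value of $\lambda_X$; that is, the primitive idempotents of $\mathbb{R}[w]$ are the elements $\sum_{X:\lambda_X=\lambda}e_X$, one for each $\lambda\in\{\lambda_X:X\in L\}$.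
   Context: A finite semigroup $S$ with identity is a left-regular band (LRB) if there are a lattice $L$ (the lattice of supports) and a surjection $\operatorname{supp}\colon S\to L$ such that $\operatorname{supp}(xy)=\operatorname{supp}x\vee\operatorname{supp}y$ for all $x,y\in S$, and $xy=x$ whenever $\operatorname{supp}y\le\operatorname{supp}x$. Let $\hat 0$ be the smallest element of $L$. $\mathbb{R}S$ is the semigroup algebra, and $\mathbb{R}[w]$ is its subalgebra with identity generated by $w$. Primitive idempotents of a commutative algebra are the nonzero idempotents that are not sums of two nonzero orthogonal idempotents. For $X\in L$, $\lambda_X=\sum_{y\in S,\ \operatorname{supp}y\le X}w_y$. A reduced word is an $l$-tuple $\mathbf{x}=(x_1,\dots,x_l)$ ($l\ge0$) of elements of $S$ such that $\operatorname{supp}x_i\nleq\operatorname{supp}(x_1\cdots x_{i-1})$ for $i=1,\dots,l$ (an empty product is the identity). Its associated chain is $\hat0=X_0<X_1<\cdots<X_l$ with $X_i=\operatorname{supp}(x_1\cdots x_i)$; put $\lambda_i=\lambda_{X_i}$, $w_{\mathbf{x}}=w_{x_1}\cdots w_{x_l}$ and $\bar{\mathbf{x}}=x_1x_2\cdots x_l\in S$. If the chain passes through $X$, say $X=X_i$, then $$R_{X,\mathbf{x}}=\frac{(-1)^{l-i}}{(\lambda_X-\lambda_0)\cdots(\lambda_X-\lambda_{i-1})(\lambda_{i+1}-\lambda_X)\cdots(\lambda_l-\lambda_X)}.$$ (Under the generation hypothesis, $X<Y$ in $L$ implies $\lambda_X<\lambda_Y$, so the denominators are nonzero.) *)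

(* Defs.v *)
From HB Require Import structures.
From mathcomp Require Export all_boot all_order all_algebra falgebra reals.

Set Implicit Arguments.
Unset Strict Implicit.
Unset Printing Implicit Defensive.

Import Order.TTheory GRing.Theory Num.Theory.
Local Open Scope ring_scope.

#[short(type="finMonoidType")]
HB.structure Definition FinMonoid := {S of Monoid S & Finite S}.

(* S is a left-regular band, L its lattice of supports. A finTBLatticeType is
   a nonempty finite lattice; L is finite and nonempty because supp is onto
   and S is finite with an identity. *)
Record is_LRB (d : Order.disp_t) (S : finMonoidType) (L : finTBLatticeType d)
    (supp : S -> L) : Prop := IsLRB {
  supp_surj : forall X : L, exists x : S, supp x = X;
  suppM : forall x y : S, supp (x * y)%g = (supp x `|` supp y)%O;
  supp_absorb : forall x y : S, (supp y <= supp x)%O -> (x * y)%g = x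
}.

(* The pointwise product of {ffun S -> R} must not be used on this alias: the
   ring structure declared below is the convolution product. *)
Definition semigroup_algebra (R : fieldType) (S : finMonoidType) : Type :=
  {ffun S -> R^o}.

Section SemigroupAlgebra.
Variables (R : fieldType) (S : finMonoidType).
Local Notation RS := (semigroup_algebra R S).
Implicit Types f g h : RS.

HB.instance Definition _ := Vector.copy RS {ffun S -> R^o}.

Definition fun_of_salg f : S -> R := fun x => (f : {ffun S -> R^o}) x.
Coercion fun_of_salg : semigroup_algebra >-> Funclass.

Definition salg_elt (x : S) : RS := [ffun y => (y == x)%:R].

Definition salg_mul f g : RS :=
  [ffun z => \sum_(x : S) \sum_(y : S | (x * y)%g == z) f x * g y].

Lemma salgP f g : f =1 g <-> f = g.
Proof. by split=> [|-> //]; move=> fg; apply/ffunP=> x; apply: fg. Qed.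

Lemma salg_eltE x y : salg_elt x y = (y == x)%:R.
Proof. by rewrite /fun_of_salg ffunE. Qed.

Lemma salg_mulE f g z :
  salg_mul f g z = \sum_(x : S) \sum_(y : S | (x * y)%g == z) f x * g y.
Proof. by rewrite /fun_of_salg ffunE. Qed.

Lemma salg_addE f g z : (f + g : RS) z = f z + g z.
Proof. by rewrite /fun_of_salg ffunE. Qed.

Lemma salg_scaleE (a : R) f z : (a *: f : RS) z = a * f z.
Proof. by rewrite /fun_of_salg ffunE. Qed.

Lemma salg_mul_sum f g (F : S -> R) :
  \sum_u salg_mul f g u * F u = \sum_x \sum_y f x * g y * F (x * y)%g.
Proof.
under eq_bigr => u _.
  rewrite salg_mulE mulr_suml.
  under eq_bigr => x _ do rewrite mulr_suml big_mkcond /=.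
  over.
rewrite exchange_big; apply: eq_bigr => x _ /=.
rewrite exchange_big; apply: eq_bigr => y _ /=.
by rewrite -big_mkcond (big_pred1 (x * y)%g) // => u; rewrite eq_sym.
Qed.

Lemma salg_mulA : associative salg_mul.
Proof.
move=> f g h; apply/salgP => z; rewrite !salg_mulE.
transitivity (\sum_x \sum_y f x * g y *
    (\sum_(v | ((x * y) * v)%g == z) h v)); last first.
  rewrite -(salg_mul_sum _ _ (fun u => \sum_(v | (u * v)%g == z) h v)).
  by apply: eq_bigr => u _; rewrite mulr_sumr.
apply: eq_bigr => x _; rewrite -mulr_sumr.
under [RHS]eq_bigr => y _ do rewrite -mulrA.
rewrite -mulr_sumr; congr (_ * _).
transitivity (\sum_u salg_mul g h u * ((x * u)%g == z)%:R).
  by rewrite [LHS]big_mkcond; apply: eq_bigr => u _; case: eqP;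
    rewrite ?mulr1 ?mulr0.
rewrite salg_mul_sum; apply: eq_bigr => y _; rewrite mulr_sumr [RHS]big_mkcond.
by apply: eq_bigr => v _; rewrite mulgA; case: eqP; rewrite ?mulr1 ?mulr0.
Qed.

Lemma salg_mul1 : left_id (salg_elt 1%g) salg_mul.
Proof.
move=> f; apply/salgP => z; rewrite salg_mulE (bigD1 1%g) //= [X in _ + X]big1 ?addr0.
  rewrite (eq_bigl (pred1 z)) => [|y]; last by rewrite mul1g.
  by rewrite big_pred1_eq salg_eltE eqxx mul1r.
by move=> x /negPf nx; rewrite big1 // => y _; rewrite salg_eltE nx mul0r.
Qed.

Lemma salg_mulr1 : right_id (salg_elt 1%g) salg_mul.
Proof.
move=> f; apply/salgP => z; rewrite salg_mulE (bigD1 z) //= [X in _ + X]big1 ?addr0.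
  rewrite (bigD1 1%g) ?mulg1 //= salg_eltE eqxx mulr1 big1 ?addr0 //.
  by move=> y /andP[_ /negPf ny]; rewrite salg_eltE ny mulr0.
move=> x nxz; rewrite big1 // => y /eqP xyz; rewrite salg_eltE.
by case: eqP => [y1|]; rewrite ?mulr0 //; rewrite -xyz y1 mulg1 eqxx in nxz.
Qed.

Lemma salg_mulDl : left_distributive salg_mul +%R.
Proof.
move=> f g h; apply/salgP => z; rewrite salg_addE !salg_mulE -big_split.
apply: eq_bigr => x _ /=; rewrite -big_split; apply: eq_bigr => y _ /=.
by rewrite salg_addE mulrDl.
Qed.

Lemma salg_mulDr : right_distributive salg_mul +%R.
Proof.
move=> f g h; apply/salgP => z; rewrite salg_addE !salg_mulE -big_split.
apply: eq_bigr => x _ /=; rewrite -big_split; apply: eq_bigr => y _ /=.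
by rewrite salg_addE mulrDr.
Qed.

Lemma salg_elt1_neq0 : salg_elt 1%g != 0.
Proof.
apply/eqP => /salgP/(_ 1%g)/eqP; rewrite salg_eltE eqxx /fun_of_salg ffunE.
by rewrite oner_eq0.
Qed.

HB.instance Definition _ := GRing.Zmodule_isNzRing.Build RS
  salg_mulA salg_mul1 salg_mulr1 salg_mulDl salg_mulDr salg_elt1_neq0.

Lemma salg_scaleAl (a : R) f g : a *: (f * g) = (a *: f) * g.
Proof.
apply/salgP => z; rewrite salg_scaleE !salg_mulE mulr_sumr.
apply: eq_bigr => x _; rewrite mulr_sumr; apply: eq_bigr => y _.
by rewrite salg_scaleE mulrA.
Qed.

Lemma salg_scaleAr (a : R) f g : a *: (f * g) = f * (a *: g).
Proof.
apply/salgP => z; rewrite salg_scaleE !salg_mulE mulr_sumr.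
apply: eq_bigr => x _; rewrite mulr_sumr; apply: eq_bigr => y _.
by rewrite salg_scaleE mulrCA.
Qed.

HB.instance Definition _ := GRing.Lmodule_isLalgebra.Build R RS salg_scaleAl.
HB.instance Definition _ := GRing.Lalgebra_isAlgebra.Build R RS salg_scaleAr.
HB.instance Definition _ := Algebra_isFalgebra.Build R RS.

Lemma salg_elt1 : salg_elt 1%g = 1.
Proof. by []. Qed.

Lemma salg_eltM x y : salg_elt x * salg_elt y = salg_elt (x * y)%g.
Proof.
apply/salgP => z; rewrite salg_mulE salg_eltE (bigD1 x) //= [X in _ + X]big1.
  rewrite addr0 big_mkcond (bigD1 y) //= big1 => [|v /negPf nv].
    by rewrite addr0 !salg_eltE !eqxx mulr1 eq_sym; case: eqP.
  by rewrite !salg_eltE nv mulr0 if_same.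
by move=> u /negPf nu; rewrite big1 // => v _; rewrite !salg_eltE nu mul0r.
Qed.

Lemma salg_sum f : f = \sum_x f x *: salg_elt x.
Proof.
apply/ffunP => z; rewrite sum_ffunE (bigD1 z) //= big1 => [|x nx].
  by rewrite !ffunE eqxx addr0 -[LHS]mulr1.
by rewrite !ffunE eq_sym (negPf nx) scaler0.
Qed.

End SemigroupAlgebra.

(* [generates A]: every element of S is a (possibly empty) product of elements
   of A. *)
Definition generates (S : finMonoidType) (A : {pred S}) : Prop :=
  forall x : S, exists2 s : seq S, {subset s <= A} & x = (\prod_(y <- s) y)%g.

Section Idempotents.
Variables (K : fieldType) (aT : falgType K).

Definition idempotent_in (A : {vspace aT}) (e : aT) : Prop :=
  e \in A /\ e * e = e.

Definition primitive_idempotent (A : {vspace aT}) (e : aT) : Prop :=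
  [/\ idempotent_in A e, e != 0 &
      ~ exists f g : aT,
          [/\ idempotent_in A f /\ f != 0, idempotent_in A g /\ g != 0,
              f * g = 0 /\ g * f = 0 & e = f + g]].

(* K[a]; agenv of a subspace contains 1. *)
Definition gen_subalg (a : aT) : {vspace aT} := agenv <[a]>%VS.

End Idempotents.

Section ReducedWords.
Variables (d : Order.disp_t) (S : finMonoidType) (L : finTBLatticeType d).
Variable supp : S -> L.
Implicit Types (s : seq S) (X : L).

Definition word_prod s : S := (\prod_(x <- s) x)%g.

(* The letters are s_0, ..., s_(l-1); take i s is the prefix preceding s_i. *)
Definition reduced s : bool :=
  [forall i : 'I_(size s),
     ~~ (supp (nth 1%g s i) <= supp (word_prod (take i s)))%O].

(* The associated chain X_0, ..., X_l, with l = size s. *)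
Definition chain s : seq L :=
  [seq supp (word_prod (take i s)) | i <- iota 0 (size s).+1].

Lemma supp1 : is_LRB supp -> supp 1%g = \bot%O.
Proof.
case=> surj sM _; apply/eqP; rewrite -lex0.
by have [x <-] := surj \bot%O; rewrite -[x]mul1g sM leUl.
Qed.

Lemma chain_lt s : is_LRB supp -> reduced s -> sorted <%O (chain s).
Proof.
move=> [_ sM _] /forallP red; apply/(sortedP \bot%O) => i.
rewrite size_map size_iota => lti.
rewrite !(nth_map 0%N) ?size_iota ?nth_iota ?(ltnW lti) // !add0n.
have {}lti : (i < size s)%N by [].
have := red (Ordinal lti); rewrite /= /word_prod (take_nth 1%g lti).
rewrite -cats1 big_cat big_seq1 sM lt_neqAle leUl andbT.
by apply: contra => /eqP ->; rewrite leUr.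
Qed.

(* Hence the reduced words all lie in the finite type #|L|.-bseq S. *)
Lemma reduced_size s : is_LRB supp -> reduced s -> (size s < #|L|)%N.
Proof.
move=> lrb red; have /card_uniqP := sorted_uniq lt_trans ltxx (chain_lt lrb red).
by rewrite size_map size_iota => <-; apply: max_card.
Qed.

Variables (R : fieldType) (w : semigroup_algebra R S).

Definition lam X : R := \sum_(y : S | (supp y <= X)%O) w y.

(* For X in the chain of s (which has no repetition if s is reduced), i below
   is the index such that X = X_i. *)
Definition coefR X s : R :=
  let l := size s in
  let i := index X (chain s) in
  let lambda j := lam (nth \bot%O (chain s) j) in
  (-1) ^+ (l - i) /
    ((\prod_(0 <= j < i) (lam X - lambda j)) *
     (\prod_(i.+1 <= j < l.+1) (lambda j - lam X))).

(* #|L|.-bseq S is the type of words of length at most #|L|; it contains all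
   reduced words, by reduced_size. *)
Definition idem X : semigroup_algebra R S :=
  \sum_(s : #|L|.-bseq S | reduced s && (X \in chain s))
    (coefR X s * \prod_(x <- s) w x) *: salg_elt R (word_prod s).

(* [idem X] is e_X and [lam X] is lambda_X. *)
Definition idem_group (a : R) : semigroup_algebra R S :=
  \sum_(X : L | lam X == a) idem X.

End ReducedWords.

(* Main.v *)
Require Import Defs.
Set Implicit Arguments.
Unset Strict Implicit.
Unset Printing Implicit Defensive.
Import Order.TTheory GRing.Theory Num.Theory.
Local Open Scope ring_scope.

(** Let T(s) = w_s (s_1 ... s_l) be the weighted product of a reduced word s
    with support chain X_0 < ... < X_l. A letter y with supp y <= X_l is
    absorbed by the product and any other letter prolongs the word, so
      T(s) w = lambda_l T(s) + sum_y T(s y),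
    where y runs over the letters that keep the word reduced
    ([word_term_mul]). The coefficient R_{X,s} is the partial fraction
    coefficient prod_(j <> i) (lambda_i - lambda_j)^-1 ([coefR_pfrac]), hence
    (lambda_X - lambda_l) R_{X,s} = R_{X,s'} where s' is s without its last
    letter ([word_coef_rcons]). This recursion makes the sum e_X of the
    R_{X,s} T(s) a left eigenvector: e_X w = lambda_X e_X ([idem_mul]). The
    partial fraction coefficients of a chain of length l sum to zero unless
    l = 0 ([sum_pfrac]), so the e_X sum to 1 ([idem_sum1]).

    These two facts yield everything that depends on the values lambda_X only:
    w = sum_X lambda_X e_X, and by Lagrange interpolation the sum E_a of the
    e_X with lambda_X = a is a polynomial in w which e_X reproduces if
    lambda_X = a and kills otherwise ([eigen_mul_group]). So the E_a are
    orthogonal idempotents of sum 1, R[w] acts on each of them by scalars, and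
    they are its primitive idempotents once they are nonzero
    ([primitive_idempotentP]). They are nonzero because the character of RS
    attached to X, which sends f to the sum of the f_y with supp y <= X, kills
    e_Y when lambda_Y <> lambda_X ([idem_group_neq0]).

    Individual e_X and e_Y with X <> Y and lambda_X = lambda_Y are not
    separated by polynomials in w. Here the order of L enters: X and Y are
    incomparable, because lambda is strictly increasing ([lam_lt]), so
    X \/ Y > Y. The product e_X e_Y is supported on elements of support at
    least X \/ Y, where w acts on the right by a triangular matrix with
    diagonal entries at least lambda_(X \/ Y) > lambda_Y; but
    (e_X e_Y) w = lambda_Y e_X e_Y, so e_X e_Y = 0 ([eigenvector_above0],
    [idem_mul_eq_lam]). Together with the E_a this gives e_X^2 = e_X and all
    the remaining orthogonality relations ([eigen_idempotent],
    [eigen_orthogonal]). *)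

(** * Resolutions of the identity by left eigenvectors *)

Section EigenResolution.
Variables (K : fieldType) (A : falgType K) (I : finType).
Variables (w : A) (e : I -> A) (mu : I -> K).
Hypothesis e_eigen : forall i, e i * w = mu i *: e i.
Hypothesis e_sum1 : \sum_i e i = 1.

Definition eigen_group (a : K) : A := \sum_(i | mu i == a) e i.

Lemma eigen_resolution : w = \sum_i mu i *: e i.
Proof.
by rewrite -[LHS]mul1r -e_sum1 mulr_suml; apply: eq_bigr => i _.
Qed.

(** The numerator of the Lagrange interpolation polynomial at [a], evaluated at
    [w]. The repetitions in [codom mu] are harmless: they only raise some
    factors to a power. *)
Definition eigen_sep (a : K) : A :=
  \prod_(b <- codom mu | b != a) (w - b%:A).

Lemma eigen_mul_sep i a :
  e i * eigen_sep a = (\prod_(b <- codom mu | b != a) (mu i - b)) *: e i.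
Proof.
rewrite /eigen_sep; elim: (codom mu) => [|b r IHr].
  by rewrite !big_nil mulr1 scale1r.
rewrite !big_cons; case: ifP => _ //.
rewrite mulrA mulrBr e_eigen -scalerAr mulr1 -scalerBl -scalerAl IHr scalerA.
by [].
Qed.

Lemma eigen_sep_prod_neq0 a : \prod_(b <- codom mu | b != a) (a - b) != 0.
Proof.
by rewrite prodf_seq_neq0; apply/allP => b _; apply/implyP; rewrite subr_eq0 eq_sym.
Qed.

Lemma eigen_sep_prod_eq0 i a :
  mu i != a -> \prod_(b <- codom mu | b != a) (mu i - b) = 0.
Proof.
move=> mu_a; apply/eqP; rewrite prodf_seq_eq0; apply/hasP; exists (mu i).
  exact: codom_f.
by rewrite mu_a subrr eqxx.
Qed.

(** Multiply the resolution of 1 by the separating polynomial: it acts on each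
    [e i] by its value at [mu i], which vanishes unless [mu i = a]. *)
Lemma eigen_sepE a :
  eigen_sep a = (\prod_(b <- codom mu | b != a) (a - b)) *: eigen_group a.
Proof.
rewrite -[LHS]mul1r -e_sum1 mulr_suml scaler_sumr [RHS]big_mkcond.
apply: eq_bigr => i _; rewrite eigen_mul_sep; case: eqP => [-> //|/eqP mu_a].
by rewrite eigen_sep_prod_eq0 // scale0r.
Qed.

(** [eigen_group a] is a multiple of a polynomial in [w], and such polynomials
    act on the eigenvector [e i] by scalars. *)
Lemma eigen_mul_group i a : e i * eigen_group a = (mu i == a)%:R *: e i.
Proof.
apply: (scalerI (eigen_sep_prod_neq0 a)).
rewrite scalerAr -eigen_sepE eigen_mul_sep scalerA; congr (_ *: _).
case: eqP => [-> | /eqP mu_a]; first by rewrite mulr1.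
by rewrite eigen_sep_prod_eq0 // mulr0.
Qed.

Lemma sum_eigen_group (c : K -> K) :
  \sum_(a <- undup (codom mu)) c a *: eigen_group a = \sum_i c (mu i) *: e i.
Proof.
under eq_bigr => a _ do rewrite scaler_sumr.
rewrite (exchange_big_dep xpredT) //=; apply: eq_bigr => i _.
rewrite -big_filter (eq_filter (a2 := pred1 (mu i))) => [|a]; last exact: eq_sym.
by rewrite filter_pred1_uniq ?undup_uniq ?mem_undup ?codom_f // big_seq1.
Qed.

Lemma eigen_group_sum1 : \sum_(a <- undup (codom mu)) eigen_group a = 1.
Proof.
have := sum_eigen_group (fun=> 1); rewrite (eq_bigr e) ?e_sum1 => [<-|i _].
  by apply: eq_bigr => a _; rewrite scale1r.
exact: scale1r.
Qed.

Lemma eigen_groupM a b :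
  eigen_group a * eigen_group b = (a == b)%:R *: eigen_group b.
Proof.
rewrite {1}/eigen_group mulr_suml.
under eq_bigr => i /eqP mu_a do rewrite eigen_mul_group mu_a.
by rewrite -scaler_sumr; case: eqP => [->//|_]; rewrite !scale0r.
Qed.

Lemma eigen_group_inj a b :
  eigen_group a != 0 -> eigen_group a = eigen_group b -> a = b.
Proof.
move=> a_neq0 ab; apply: contraNeq a_neq0 => /negPf a_b.
have aa : eigen_group a * eigen_group a = eigen_group a.
  by rewrite eigen_groupM eqxx scale1r.
by rewrite -aa {2}ab eigen_groupM a_b scale0r.
Qed.

Lemma mul_eigen_group a : w * eigen_group a = a *: eigen_group a.
Proof.
rewrite {1}eigen_resolution mulr_suml scaler_sumr [RHS]big_mkcond.
apply: eq_bigr => i _; rewrite -scalerAl eigen_mul_group scalerA.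
by case: eqP => [->|_]; rewrite ?mulr1 ?mulr0 ?scale0r.
Qed.

Lemma eigen_group_mem a : eigen_group a \in gen_subalg w.
Proof.
have wA : w \in gen_subalg w by rewrite (subvP (sub_agenv _)) ?memv_line.
have oneA : 1 \in gen_subalg w by rewrite memvE sub1_agenv.
have mulA u v : u \in gen_subalg w -> v \in gen_subalg w -> u * v \in gen_subalg w.
  by move=> Au Av; rewrite -[gen_subalg w]agenvM memv_mul.
rewrite -[eigen_group a]scale1r -(mulVf (eigen_sep_prod_neq0 a)) -scalerA.
rewrite -eigen_sepE memvZ // /eigen_sep; elim/big_rec: _ => // b v _ Av.
by rewrite mulA // rpredB ?memvZ.
Qed.

(** The [f] with this property form a subspace containing 1 and stable under
    left multiplication by [w]. *)
Lemma gen_subalg_mul_group f a :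
  f \in gen_subalg w -> f * eigen_group a \in <[eigen_group a]>%VS.
Proof.
pose V := (amulr (eigen_group a) @^-1: <[eigen_group a]>)%VS.
have VE u : (u \in V) = (u * eigen_group a \in <[eigen_group a]>%VS).
  by rewrite -memv_preim lfunE.
suff /subvP sub : (gen_subalg w <= V)%VS by move/sub; rewrite VE.
apply: agenv_sub_modl; first by rewrite -memvE VE mul1r memv_line.
apply/prodvP => _ v /vlineP[k ->]; rewrite !VE => /vlineP[c vE].
by rewrite -mulrA vE -scalerAr -scalerAl mul_eigen_group !memvZ ?memv_line.
Qed.

Lemma gen_subalg_group_comm f a :
  f \in gen_subalg w -> eigen_group a * f = f * eigen_group a.
Proof.
move=> Af; rewrite -[f in LHS]mulr1 -[eigen_group a in RHS]mulr1.
rewrite -eigen_group_sum1 !mulr_sumr; apply: eq_bigr => b _.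
have /vlineP[k fE] := gen_subalg_mul_group b Af.
by rewrite eigen_groupM -scalerAr fE -scalerAr eigen_groupM !scalerA mulrC.
Qed.

Lemma idempotent_mul_group f a : idempotent_in (gen_subalg w) f ->
  f * eigen_group a = 0 \/ f * eigen_group a = eigen_group a.
Proof.
case=> Af ff; have /vlineP[k fE] := gen_subalg_mul_group a Af.
have kk : (k * k) *: eigen_group a = k *: eigen_group a.
  by rewrite -scalerA -fE scalerAr -fE mulrA ff.
have /eqP := kk; rewrite -subr_eq0 -scalerBl scaler_eq0 -{3}[k]mulr1 -mulrBr.
rewrite mulf_eq0 subr_eq0 -orbA => /or3P[] /eqP E; rewrite fE E ?scale0r.
- by left.
- by right; rewrite scale1r.
- by left; rewrite scaler0.
Qed.

(** An idempotent of the subalgebra acts on each group as 0 or 1. If [f] is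
    primitive, some group survives in it and is then all of [f], since the rest
    would be an orthogonal idempotent. Conversely both terms of a
    decomposition of a group would be equal to that group. *)
Lemma primitive_idempotentP : (forall i, eigen_group (mu i) != 0) ->
  forall f, primitive_idempotent (gen_subalg w) f <->
            exists2 a, a \in codom mu & f = eigen_group a.
Proof.
move=> group_neq0 f; split.
  case=> -[Af ff] f_neq0 f_min.
  have [a ra fa_neq0] : exists2 a, a \in codom mu & f * eigen_group a != 0.
    have : has (fun a => f * eigen_group a != 0) (codom mu).
      apply/negPn; rewrite -all_predC; apply/negP => /allP f0.
      case/eqP: f_neq0; rewrite -[f]mulr1 -eigen_group_sum1 mulr_sumr.
      rewrite big_seq big1 // => a; rewrite mem_undup => /f0.
      by rewrite /= negbK => /eqP.
    by case/hasP => a; exists a.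
  exists a => //; have [fa|fa] := idempotent_mul_group a (conj Af ff).
    by rewrite fa eqxx in fa_neq0.
  apply/eqP; rewrite -subr_eq0; apply: contraT => fa'_neq0; case: f_min.
  have aa : eigen_group a * eigen_group a = eigen_group a.
    by rewrite eigen_groupM eqxx scale1r.
  have af : eigen_group a * f = eigen_group a.
    by rewrite gen_subalg_group_comm.
  exists (eigen_group a), (f - eigen_group a); split.
  - by rewrite -{2}fa; split=> //; split=> //; apply: eigen_group_mem.
  - split=> //; split; first by rewrite memvB ?eigen_group_mem.
    by rewrite mulrBr !mulrBl fa aa subrr subr0 ff af.
  - by rewrite mulrBr mulrBl af aa fa subrr.
  - by rewrite addrC subrK.
case=> _ /codomP[i ->] ->; set a := mu i.
have aa : eigen_group a * eigen_group a = eigen_group a.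
  by rewrite eigen_groupM eqxx scale1r.
split; [by split=> //; apply: eigen_group_mem | exact: group_neq0 |].
case=> g [h [[Ag g_neq0] [Ah h_neq0] [gh hg] aE]].
have {}ga : g * eigen_group a = g by rewrite aE mulrDr (proj2 Ag) gh addr0.
have {}ha : h * eigen_group a = h by rewrite aE mulrDr (proj2 Ah) hg add0r.
have gE : g = eigen_group a.
  by have [ga0|<- //] := idempotent_mul_group a Ag; case/eqP: g_neq0; rewrite -ga.
have hE : h = eigen_group a.
  by have [ha0|<- //] := idempotent_mul_group a Ah; case/eqP: h_neq0; rewrite -ha.
by case/eqP: g_neq0; rewrite -(proj2 Ag) {2}gE -hE.
Qed.

Hypothesis e_ortho_eq : forall i j, i != j -> mu i = mu j -> e i * e j = 0.

(** In [e i * eigen_group (mu i) = e i] all cross terms vanish. *)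
Lemma eigen_idempotent i : e i * e i = e i.
Proof.
have := eigen_mul_group i (mu i); rewrite eqxx scale1r => e_grp.
rewrite -[RHS]e_grp mulr_sumr (bigD1 i) //= big1 ?addr0 // => j /andP[/eqP mu_ji ji].
by rewrite e_ortho_eq // eq_sym.
Qed.

(** For different eigenvalues, insert between the two factors the group of
    [e j], which fixes [e j] and is killed by [e i]. *)
Lemma eigen_orthogonal i j : i != j -> e i * e j = 0.
Proof.
move=> ij; have [mu_ij | mu_ij] := eqVneq (mu i) (mu j); first exact: e_ortho_eq.
have <- : eigen_group (mu j) * e j = e j.
  rewrite mulr_suml (bigD1 j) //= eigen_idempotent big1 ?addr0 // => k /andP[/eqP].
  by move=> mu_kj kj; apply: e_ortho_eq.
by rewrite mulrA eigen_mul_group (negPf mu_ij) scale0r mul0r.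
Qed.

End EigenResolution.

(** * Partial fractions *)

Section PartialFractions.
Variable F : fieldType.
Implicit Types (c : seq F) (a b : F).

(** The residue at [a] of the rational function prod_(b in c) 1 / (x - b), if
    [c] has no repetition and contains [a]. *)
Definition pfrac c a : F := \prod_(b <- c | b != a) (a - b)^-1.

Lemma perm_pfrac c c' a : perm_eq c c' -> pfrac c a = pfrac c' a.
Proof. exact: perm_big. Qed.

Lemma pfrac_cons b c a : a != b -> (a - b) * pfrac (b :: c) a = pfrac c a.
Proof.
by move=> ab; rewrite /pfrac big_cons eq_sym ab mulVKf // subr_eq0.
Qed.

Lemma pfrac_rcons b c a : a != b -> (a - b) * pfrac (rcons c b) a = pfrac c a.
Proof. by rewrite (perm_pfrac _ (_ : perm_eq _ (b :: c))) ?perm_rcons //; apply: pfrac_cons. Qed.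

Lemma sum_pfrac_cons b c : uniq (b :: c) ->
  \sum_(a <- b :: c) (a - b) * pfrac (b :: c) a = \sum_(a <- c) pfrac c a.
Proof.
case/andP=> bc _; rewrite big_cons subrr mul0r add0r big_seq [RHS]big_seq.
by apply: eq_bigr => a ac; rewrite pfrac_cons //; apply: contraNneq bc => <-.
Qed.

(** With x and y the first two entries of [c], write
    y - x = (a - x) - (a - y): by [sum_pfrac_cons], (y - x) times the sum is
    the difference of the sums for [c] without x and [c] without y, which are
    equal by induction. *)
Lemma sum_pfrac c : uniq c -> \sum_(a <- c) pfrac c a = (size c == 1%N)%:R.
Proof.
have [n] := ubnP (size c); elim: n c => // n IHn [|x [|y c]] /= size_c c_uniq.
- by rewrite big_nil.
- by rewrite big_seq1 /pfrac big_cons eqxx big_nil.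
have perm_xy : perm_eq [:: y, x & c] [:: x, y & c].
  by apply/permPl/(perm_catCA [:: y] [:: x] c).
have yx : y - x != 0.
  by move: c_uniq; rewrite inE negb_or subr_eq0 eq_sym => /andP[/andP[]].
apply: (mulfI yx); rewrite mulr0 mulr_sumr.
have split_yx a : y - x = (a - x) - (a - y) by rewrite opprB [RHS]addrC subrKA.
under eq_bigr => a _ do rewrite (split_yx a) mulrBl.
rewrite big_split /= sumrN sum_pfrac_cons // -(perm_big _ perm_xy) /=.
under [X in _ - X]eq_bigr => a _ do rewrite -(perm_pfrac _ perm_xy).
rewrite sum_pfrac_cons ?(perm_uniq perm_xy) // !IHn //=.
- by rewrite subrr.
- by case/andP: c_uniq.
- by case/and3P: c_uniq => + _ ->; rewrite inE negb_or => /andP[_ ->].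
Qed.

End PartialFractions.

(** * Sums over words of bounded length *)

Section BoundedWords.
Variables (T : finType) (V : nmodType) (n : nat).

Lemma sum_bseq_rcons (P : pred (seq T)) (F : seq T -> V) :
  (forall s, P s -> (size s <= n)%N) ->
  \sum_(s : n.-bseq T | P s && (s != [::] :> seq T)) F s =
  \sum_(s : n.-bseq T) \sum_(y | P (rcons s y)) F (rcons s y).
Proof.
move=> P_size; rewrite pair_big_dep /=.
have insubK (s : seq T) : (size s <= n)%N -> insub_bseq n s = s :> seq T.
  by move=> s_n; rewrite /insub_bseq insubdK.
have takeK (s : seq T) y : take (size (rcons s y)).-1 (rcons s y) = s.
  by rewrite size_rcons -cats1 take_size_cat.
case: (pickP (@predT T)) => [x0 _ | T0]; last first.
  rewrite !big_pred0 // => [[s y]|[[|x s] s_n]]; first by have := T0 y.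
    by rewrite andbF.
  by have := T0 x.
(* A nonempty word is determined by its last letter and what precedes it. A
   word that is too long is sent to the empty word by [h], which the condition
   [s != [::]] excludes. *)
pose h (p : n.-bseq T * T) := insub_bseq n (rcons p.1 p.2).
pose h' (s : n.-bseq T) := (insub_bseq n (take (size s).-1 s), last x0 s).
rewrite (reindex_onto h h') => [|s /andP[_ s_nil]]; last first.
  apply: val_inj; rewrite /h /h' /= [X in rcons X]insubK; last first.
    by rewrite size_take_min geq_min (size_bseq s) orbT.
  case: s s_nil => s s_n /=; case/lastP: s s_n => // s y s_n _.
  by rewrite takeK last_rcons insubK.
have h_rcons s y : h (s, y) != [::] :> seq T -> h (s, y) = rcons s y :> seq T.
  have [s_n _ | s_n] := leqP (size (rcons s y)) n; first exact: insubK.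
  by rewrite /h /= /insub_bseq /insubd insubN -?ltnNge.
apply: eq_big => [[s y]|[s y] /andP[/andP[_ /h_rcons -> //]]].
apply/andP/idP => [[/andP[P_h /h_rcons hE]] _ | P_sy]; first by rewrite -hE.
have hE : h (s, y) = rcons s y :> seq T by apply/insubK/P_size.
rewrite hE P_sy -size_eq0 size_rcons; split=> //.
rewrite /h' hE takeK last_rcons; apply/eqP; congr (_, _).
by apply: val_inj; rewrite /= insubK ?size_bseq.
Qed.

End BoundedWords.

(** * The semigroup algebra of a left-regular band *)

Section AlgebraCoefficients.
Variables (R : fieldType) (S : finMonoidType).
Implicit Types f g : semigroup_algebra R S.

Lemma salg_0E z : (0 : semigroup_algebra R S) z = 0.
Proof. by rewrite /fun_of_salg ffunE. Qed.

Lemma salg_sumE (I : finType) (P : pred I) (F : I -> semigroup_algebra R S) z :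
  (\sum_(i | P i) F i) z = \sum_(i | P i) F i z.
Proof.
by apply: (big_morph (fun f : semigroup_algebra R S => f z)) => [f g|];
  rewrite ?salg_addE ?salg_0E.
Qed.

End AlgebraCoefficients.

Section LeftRegularBand.
Variables (d : Order.disp_t) (S : finMonoidType) (L : finTBLatticeType d).
Variables (supp : S -> L) (lrb : is_LRB supp).
Implicit Types (s : seq S) (X Y : L).

Let sM x y : supp (x * y)%g = (supp x `|` supp y)%O := suppM lrb x y.

Lemma word_prod_rcons s y : word_prod (rcons s y) = (word_prod s * y)%g.
Proof. by rewrite /word_prod -cats1 big_cat big_seq1. Qed.

Lemma chain_rcons s y :
  chain supp (rcons s y) = rcons (chain supp s) (supp (word_prod s * y)%g).
Proof.
rewrite /chain size_rcons -[(size s).+2]addn1 iotaD cats1 map_rcons add0n.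
rewrite take_oversize ?size_rcons // word_prod_rcons; congr rcons.
apply/eq_in_map => i; rewrite mem_iota add0n ltnS => /= i_s.
by rewrite -cats1 takel_cat.
Qed.

Lemma chain_nil : chain supp [::] = [:: \bot%O].
Proof. by rewrite /chain /= /word_prod big_nil (supp1 lrb). Qed.

Lemma reduced_rcons s y :
  reduced supp (rcons s y) =
  reduced supp s && ~~ (supp y <= supp (word_prod s))%O.
Proof.
apply/forallP/andP => [red | [/forallP red y_s] [i i_sy] /=].
  split; last first.
    have s_lt : (size s < size (rcons s y))%N by rewrite size_rcons.
    have := red (Ordinal s_lt).
    by rewrite /= nth_rcons ltnn eqxx -cats1 take_size_cat.
  apply/forallP => i; have i_lt : (i < size (rcons s y))%N.
    by rewrite size_rcons ltnS ltnW.
  have := red (Ordinal i_lt); rewrite /= nth_rcons ltn_ord -cats1 takel_cat //.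
  by rewrite ltnW.
move: i_sy; rewrite size_rcons ltnS leq_eqVlt nth_rcons -cats1.
case/orP => [/eqP -> | i_s]; first by rewrite ltnn eqxx take_size_cat.
by rewrite i_s takel_cat ?(ltnW i_s) //; apply: (red (Ordinal i_s)).
Qed.

Lemma chain_le X s : X \in chain supp s -> (X <= supp (word_prod s))%O.
Proof.
case/mapP => i _ ->; rewrite -{2}(cat_take_drop i s) /word_prod big_cat sM.
exact: leUl.
Qed.

Section Algebra.
Variable R : fieldType.
Local Notation RS := (semigroup_algebra R S).
Implicit Types f g : RS.

Lemma lam1 X : lam supp (1 : RS) X = 1.
Proof.
rewrite /lam (bigD1 1%g) /= ?(supp1 lrb) ?le0x // salg_eltE eqxx.
by rewrite big1 ?addr0 // => y /andP[_ /negPf y1]; rewrite salg_eltE y1.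
Qed.

(** As a function of the element of the algebra, [lam supp _ X] is the character
    attached to X: it is multiplicative because supp (x y) <= X if and only if
    supp x <= X and supp y <= X. *)
Lemma lamM X f g : lam supp (f * g) X = lam supp f X * lam supp g X.
Proof.
have lamE h : lam supp h X = \sum_y h y * (supp y <= X)%O%:R.
  rewrite /lam big_mkcond; apply: eq_bigr => y _.
  by case: ifP; rewrite ?mulr1 ?mulr0.
rewrite !lamE salg_mul_sum mulr_suml; apply: eq_bigr => x _.
rewrite mulr_sumr; apply: eq_bigr => y _.
by rewrite sM leUx mulrACA -natrM mulnb.
Qed.

Lemma lamZ X a f : lam supp (a *: f) X = a * lam supp f X.
Proof. by rewrite /lam mulr_sumr; apply: eq_bigr => y _; rewrite salg_scaleE. Qed.

Lemma lam_sum X (I : finType) (P : pred I) (F : I -> RS) :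
  lam supp (\sum_(i | P i) F i) X = \sum_(i | P i) lam supp (F i) X.
Proof.
rewrite /lam [RHS]exchange_big; apply: eq_bigr => y _; exact: salg_sumE.
Qed.

Definition supported_above X f := forall z, f z != 0 -> (X <= supp z)%O.

Lemma supported_aboveM X Y f g : supported_above X f -> supported_above Y g ->
  supported_above (X `|` Y)%O (f * g).
Proof.
move=> fX gY z; apply: contraNT => z_XY; rewrite salg_mulE.
rewrite big1 // => x _; rewrite big1 // => y /eqP xy.
apply/eqP; rewrite mulf_eq0; apply: contraNT z_XY; rewrite negb_or.
by case/andP=> /fX Xx /gY Yy; rewrite -xy sM leU2.
Qed.

Variable w : RS.

(** * The elements e_X as sums over reduced words *)

Definition word_term s : RS := (\prod_(x <- s) w x) *: salg_elt R (word_prod s).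

(** R_{X,s}, extended by zero to the words whose chain misses X, so that sums
    over words do not depend on X. *)
Definition word_coef X s : R :=
  if X \in chain supp s
  then pfrac (map (lam supp w) (chain supp s)) (lam supp w X) else 0.

(** The letters below the support of the product are absorbed by it and
    contribute the eigenvalue; the others prolong the word. *)
Lemma word_term_mul s :
  word_term s * w = lam supp w (supp (word_prod s)) *: word_term s +
    \sum_(y | ~~ (supp y <= supp (word_prod s))%O) word_term (rcons s y).
Proof.
rewrite {1}[w]salg_sum mulr_sumr (bigID (fun y => supp y <= supp (word_prod s))%O).
rewrite /= /lam scaler_suml; congr (_ + _); apply: eq_bigr => y.
  move=> ys; rewrite -scalerAr /word_term -scalerAl salg_eltM.
  by rewrite (supp_absorb lrb).
move=> _; rewrite -scalerAr /word_term -scalerAl salg_eltM word_prod_rcons scalerA.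
by rewrite -cats1 big_cat big_seq1 mulrC.
Qed.

(** The sign in R_{X,s} reverses the differences lambda_j - lambda_X for
    j > i. *)
Lemma coefR_pfrac X s : uniq (map (lam supp w) (chain supp s)) ->
  X \in chain supp s ->
  coefR supp w X s = pfrac (map (lam supp w) (chain supp s)) (lam supp w X).
Proof.
have -> : coefR supp w X s = 
  let c := chain supp s in let l := (size c).-1 in let i := index X c in
  (-1) ^+ (l - i) /
    ((\prod_(0 <= j < i) (lam supp w X - lam supp w (nth \bot%O c j))) *
     (\prod_(i.+1 <= j < l.+1) (lam supp w (nth \bot%O c j) - lam supp w X))).
  by rewrite /coefR /= size_map size_iota.
move: (chain supp s) => c c_uniq Xc; set lX := lam supp w X; set i := index X c.
have i_lt : (i < size c)%N by rewrite index_mem.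
have nthE j : (j < size c)%N -> (lam supp w (nth \bot%O c j) != lX) = (j != i).
  move=> j_lt; have -> : lX = lam supp w (nth \bot%O c i) by rewrite nth_index.
  by rewrite -!(nth_map _ 0 (lam supp w)) // nth_uniq ?size_map.
rewrite /= -/i /pfrac [RHS]big_map [RHS](big_nth \bot%O).
rewrite [RHS](big_cat_nat (n := i)) ?(ltnW i_lt) //=.
rewrite [X in _ = _ * X]big_ltn_cond // nthE // eqxx /=.
have -> : \prod_(0 <= j < i | lam supp w (nth \bot%O c j) != lX)
            (lX - lam supp w (nth \bot%O c j))^-1 =
          (\prod_(0 <= j < i) (lX - lam supp w (nth \bot%O c j)))^-1.
  rewrite -prodfV big_nat_cond [RHS]big_nat_cond; apply: eq_bigl => j.
  rewrite andbT /=; case: leqP => //= j_i; rewrite nthE ?(ltn_trans j_i) //.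
  by rewrite ltn_eqF.
have -> : \prod_(i.+1 <= j < size c | lam supp w (nth \bot%O c j) != lX)
            (lX - lam supp w (nth \bot%O c j))^-1 =
          (-1) ^+ ((size c).-1 - i) *
          (\prod_(i.+1 <= j < size c) (lam supp w (nth \bot%O c j) - lX))^-1.
  have -> : (-1 : R) ^+ ((size c).-1 - i) = \prod_(i.+1 <= j < size c) (-1)^-1.
    by rewrite prodr_const_nat invrN invr1 subnS -subn1 subnAC subn1.
  rewrite -prodfV -big_split big_nat_cond [RHS]big_nat_cond.
  apply: eq_big => j; last by move=> _ /=; rewrite -invfM mulN1r opprB.
  rewrite andbT /=; case: (ltnP j (size c)) => j_c; rewrite ?andbF //= nthE //.
  by rewrite andbT; case: ltngtP.
by rewrite (ltn_predK i_lt) invfM mulrCA.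
Qed.

Lemma idemE X :
  (forall s, reduced supp s -> uniq (map (lam supp w) (chain supp s))) ->
  idem supp w X =
  \sum_(s : #|L|.-bseq S | reduced supp s) word_coef X s *: word_term s.
Proof.
move=> chain_uniq; rewrite /idem [LHS]big_mkcond [RHS]big_mkcond.
apply: eq_bigr => s _; case: ifP => red_s; last first.
  by case: ifP => //= red; rewrite red /= in red_s; rewrite /word_coef red_s scale0r.
case/andP: red_s => red_s Xs; rewrite red_s /word_coef Xs /word_term scalerA.
by rewrite coefR_pfrac // chain_uniq.
Qed.

Hypothesis chain_uniq :
  forall s, reduced supp s -> uniq (map (lam supp w) (chain supp s)).

(** The factor removes the last denominator of the partial fraction coefficient.
    When X is the last element of the chain the factor vanishes, and X is not in
    the chain of the shorter word. *)
Lemma word_coef_rcons X s y : reduced supp (rcons s y) ->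
  (lam supp w X - lam supp w (supp (word_prod (rcons s y)))) *
    word_coef X (rcons s y) = word_coef X s.
Proof.
move=> red; have := chain_uniq red; rewrite /word_coef chain_rcons -word_prod_rcons.
set Z := supp _; rewrite map_rcons rcons_uniq mem_rcons inE => /andP[Z_s _].
have [Xs | Xs] := boolP (X \in chain supp s).
  rewrite orbT pfrac_rcons //; apply: contraNneq Z_s => <-; exact: map_f.
by rewrite orbF; case: eqP => [->|_]; rewrite ?subrr ?mul0r ?mulr0.
Qed.

Lemma word_coef_nil X : word_coef X [::] = (X == \bot%O)%:R.
Proof.
rewrite /word_coef chain_nil inE; case: eqP => // ->.
by rewrite /pfrac big_cons eqxx big_nil.
Qed.

(** Comparing the coefficients of [word_term s] on both sides is the recursion
    [word_coef_rcons]. *)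
Lemma idem_mul X : idem supp w X * w = lam supp w X *: idem supp w X.
Proof.
rewrite idemE // mulr_suml scaler_sumr.
under eq_bigr => s _ do rewrite -scalerAl word_term_mul scalerDr.
rewrite big_split /= addrC; apply/eqP; rewrite eq_sym -subr_eq -sumrB; apply/eqP.
pose F s := (lam supp w X - lam supp w (supp (word_prod s))) *:
              (word_coef X s *: word_term s).
(* The difference of the diagonal parts vanishes at the empty word:
   the coefficient is zero unless X is the bottom of L, and then lambda_l is
   lambda_X. *)
transitivity (\sum_(s : #|L|.-bseq S | reduced supp s && (s != [::] :> seq S)) F s).
  rewrite [RHS]big_mkcondr /=; apply: eq_bigr => s _; rewrite /F.
  rewrite scalerBl [_ *: (lam _ _ _ *: _)]scalerA mulrC -scalerA.
  case: eqP => //= ->; rewrite word_coef_nil /word_prod big_nil (supp1 lrb).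
  by case: eqP => [-> | _]; rewrite ?subrr // !scale0r !scaler0 subrr.
rewrite (sum_bseq_rcons F) => [|s /(reduced_size lrb)/ltnW //].
rewrite [RHS]big_mkcond; apply: eq_bigr => s _.
case: ifP => red_s; last by rewrite big_pred0 // => y; rewrite reduced_rcons red_s.
rewrite scaler_sumr; apply: eq_big => [y | y red]; first by rewrite reduced_rcons red_s.
by rewrite /F scalerA word_coef_rcons.
Qed.

(** Exchanging the sums over X and s, the coefficient of [word_term s] is a sum
    of partial fraction coefficients over the chain of s, which has one more
    element than s. *)
Lemma sum_word_coef s : reduced supp s -> \sum_X word_coef X s = (s == [::])%:R.
Proof.
move=> red; rewrite /word_coef -big_mkcond /= -big_uniq; last first.
  exact: map_uniq (chain_uniq red).
rewrite -(big_map (lam supp w) predT (pfrac _)) sum_pfrac ?chain_uniq //.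
by rewrite !size_map size_iota eqSS size_eq0.
Qed.

Lemma idem_sum1 : \sum_X idem supp w X = 1.
Proof.
under eq_bigr => X _ do rewrite idemE //.
rewrite exchange_big /=.
under eq_bigr => s red do rewrite -scaler_suml sum_word_coef //.
rewrite (bigD1 [bseq]) /=; last by apply/forallP => -[].
rewrite scale1r big1 => [|s /andP[_ /negPf s_nil]]; last first.
  by rewrite -[_ == _ :> seq S]/(s == [bseq]) s_nil scale0r.
by rewrite addr0 /word_term /word_prod !big_nil scale1r.
Qed.

Lemma idem_supported X : supported_above X (idem supp w X).
Proof.
move=> z; apply: contraNT => Xz; rewrite [idem _ _ _ _]salg_sumE big1 // => s /andP[_ Xs].
rewrite salg_scaleE salg_eltE; case: eqP => [zs|_]; last by rewrite mulr0.
by rewrite zs (chain_le Xs) in Xz.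
Qed.

End Algebra.

(** * Monotonicity of the eigenvalues and its consequences *)

Section Positive.
Variables (R : realFieldType) (w : semigroup_algebra R S).
Hypothesis w_ge0 : forall x, 0 <= w x.
Hypothesis w_gen : generates [pred x : S | w x != 0].

(** An element of support Y is a product of letters of positive weight. Their
    supports are at most Y, and they cannot all be at most X. *)
Lemma lam_lt X Y : (X < Y)%O -> lam supp w X < lam supp w Y.
Proof.
move=> XY; have XleY := ltW XY.
have [y /andP[yY yX] wy] : exists2 y, (supp y <= Y)%O && ~~ (supp y <= X)%O & w y != 0.
  have [z zY] := supp_surj lrb Y; have [s s_w zE] := w_gen z.
  have sY : (supp (word_prod s) <= Y)%O by rewrite /word_prod -zE zY.
  have : ~~ (supp (word_prod s) <= X)%O.
    by rewrite /word_prod -zE zY lt_geF.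
  elim: s s_w sY {zE} => [|y s IHs] s_w; first by rewrite /word_prod big_nil (supp1 lrb) !le0x.
  rewrite /word_prod big_cons sM !leUx => /andP[yY sY].
  rewrite negb_and => /orP[yX | sX].
    by exists y; rewrite ?yY //; apply: s_w; rewrite mem_head.
  by apply: IHs => // x xs; apply: s_w; rewrite inE xs orbT.
rewrite /lam [ltRHS](bigID (fun y => (supp y <= X)%O)) /=.
rewrite [X in _ < X + _](eq_bigl (fun y => (supp y <= X)%O)); last first.
  by move=> x; apply: andb_idl => /le_trans; apply.
rewrite ltrDl (bigD1 y) /= ?yY // ltr_pwDl //; first by rewrite lt_neqAle eq_sym wy w_ge0.
by apply: sumr_ge0.
Qed.

Lemma chain_lam_uniq s : reduced supp s -> uniq (map (lam supp w) (chain supp s)).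
Proof.
move=> red; apply: (sorted_uniq lt_trans ltxx); apply: (homo_sorted (e := <%O)).
  by move=> X Y; apply: lam_lt.
exact: chain_lt.
Qed.

(** Right multiplication by w is triangular: x y has support at least supp x,
    with equality only if x y = x. If f is nonzero, take z with [f z != 0] and
    [lam supp w (supp z)] minimal; the coefficient of f w at z is then
    lambda_(supp z) f_z, so a = lambda_(supp z) >= lambda_Z. *)
Lemma eigenvector_above0 Z a (f : semigroup_algebra R S) :
  supported_above Z f -> f * w = a *: f -> a < lam supp w Z -> f = 0.
Proof.
move=> fZ f_eigen aZ; apply/salgP => z0; rewrite salg_0E; apply/eqP.
apply: contraT => fz0.
have [z fz z_min] :=
  @arg_minP _ _ _ z0 [pred z | f z != 0] (fun z => lam supp w (supp z)) fz0.
have : (f * w) z = lam supp w (supp z) * f z.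
  rewrite [LHS]salg_mulE (bigD1 z) //= [X in _ + X]big1 ?addr0; last first.
    move=> x xz; rewrite big1 // => y /eqP xy; apply/eqP; rewrite mulf_eq0.
    apply/orP; left; apply: contraNT xz => fx.
    have := z_min _ fx; rewrite leNgt -xy; apply: contraNT => x_xy.
    apply: lam_lt; rewrite sM lt_neqAle leUl andbT.
    by apply: contra x_xy => /eqP xE; rewrite (supp_absorb lrb) // xE leUr.
  rewrite -mulr_sumr mulrC; congr (_ * _); apply: eq_bigl => y.
  apply/eqP/idP => [zy | yz]; last exact: (supp_absorb lrb).
  by rewrite -zy sM leUr.
rewrite f_eigen [LHS]salg_scaleE => /(mulIf fz) aE.
have := fZ z fz; rewrite le_eqVlt => /orP[/eqP Zz | /lam_lt].
  by rewrite aE Zz ltxx in aZ.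
by move/(lt_trans aZ); rewrite aE ltxx.
Qed.

(** The product is supported above the join of X and Y, which is strictly above
    Y as X and Y are incomparable, so lambda_Y is too small to be an eigenvalue
    there. *)
Lemma idem_mul_eq_lam X Y : X != Y -> lam supp w X = lam supp w Y ->
  idem supp w X * idem supp w Y = 0.
Proof.
move=> XY lamXY; apply: (eigenvector_above0 (Z := (X `|` Y)%O) (a := lam supp w Y)).
- by apply: supported_aboveM; apply: idem_supported.
- by rewrite -mulrA idem_mul ?scalerAr //; apply: chain_lam_uniq.
apply: lam_lt; rewrite lt_neqAle leUr andbT; apply: contra XY => /eqP YE.
have : (X <= Y)%O by rewrite YE leUl.
rewrite le_eqVlt => /orP[//|/lam_lt]; by rewrite lamXY ltxx.
Qed.

(** The character attached to X takes the value lambda_X at w, so it kills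
    [idem supp w Y] when lambda_Y <> lambda_X, yet its value at 1, the sum of
    all the [idem supp w Y], is 1. *)
Lemma idem_group_neq0 X : idem_group supp w (lam supp w X) != 0.
Proof.
apply/eqP => group0; have /eqP := lam1 R X; rewrite eq_sym.
rewrite -(idem_sum1 chain_lam_uniq) lam_sum (bigID (fun Y => lam supp w Y == lam supp w X)).
rewrite /= -lam_sum -/(idem_group supp w (lam supp w X)) group0 big1 => [|Y lamYX].
  rewrite /lam big1 ?addr0 ?oner_eq0 // => y _; exact: salg_0E.
have : lam supp (idem supp w Y * w) X = lam supp w Y * lam supp (idem supp w Y) X.
  by rewrite idem_mul ?lamZ //; apply: chain_lam_uniq.
rewrite lamM mulrC => /eqP; rewrite -subr_eq0 -mulrBl mulf_eq0 subr_eq0 eq_sym.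
by rewrite (negPf lamYX) => /eqP.
Qed.

End Positive.
End LeftRegularBand.

Theorem theorem6 (R : realType) (d : Order.disp_t) (S : finMonoidType)
    (L : finTBLatticeType d) (supp : S -> L) (w : semigroup_algebra R S)
    (S_LRB : is_LRB supp)
    (w_ge0 : forall x : S, 0 <= w x)
    (w_sum1 : \sum_(x : S) w x = 1)
    (w_gen : generates [pred x : S | w x != 0]) :
  [/\ (forall X : L, idem supp w X * idem supp w X = idem supp w X),
      (forall X Y : L, X != Y -> idem supp w X * idem supp w Y = 0),
      w = \sum_(X : L) lam supp w X *: idem supp w X,
      (injective (lam supp w) ->
         forall e : semigroup_algebra R S,
           primitive_idempotent (gen_subalg w) e <->
           exists X : L, e = idem supp w X)
    & [/\ (forall e : semigroup_algebra R S,
             primitive_idempotent (gen_subalg w) e <->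
             exists2 a : R, a \in codom (lam supp w) & e = idem_group supp w a),
          {in codom (lam supp w) &, injective (idem_group supp w)}
        & w = \sum_(a <- undup (codom (lam supp w)))
                a *: idem_group supp w a]].
Proof.
have chain_uniq := chain_lam_uniq S_LRB w_ge0 w_gen.
have e_eigen X := idem_mul S_LRB chain_uniq X.
have e_sum1 := idem_sum1 chain_uniq.
have e_ortho X Y := @idem_mul_eq_lam _ _ _ _ S_LRB _ _ w_ge0 w_gen X Y.
have group_neq0 X := idem_group_neq0 S_LRB w_ge0 w_gen X.
have primP := primitive_idempotentP e_eigen e_sum1 group_neq0.
split.
- exact: eigen_idempotent e_eigen e_sum1 e_ortho.
- exact: eigen_orthogonal e_eigen e_sum1 e_ortho.
- exact: eigen_resolution e_eigen e_sum1.
- move=> lam_inj e; have groupE X : idem_group supp w (lam supp w X) = idem supp w X.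
    by rewrite /idem_group (big_pred1 X) // => Y; apply: inj_eq.
  apply: iff_trans (primP e) _; split=> [[_ /codomP[X ->] ->] | [X ->]].
    by exists X; apply: groupE.
  by exists (lam supp w X); rewrite ?codom_f //; apply/esym/groupE.
split; first exact: primP.
  move=> _ b /codomP[X ->] _; apply: eigen_group_inj e_eigen e_sum1 _ _ _.
  exact: group_neq0.
rewrite [LHS](eigen_resolution e_eigen e_sum1).
exact/esym/(sum_eigen_group _ _ id).
Qed.
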